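(* Let $p\ge 1$ and let $\Gamma:\Omega\to\mathcal{K}_c(\mathbb{R}^p)$ be a compact convex random set on a probability space $(\Omega,\mathcal{A},\mathbb{P})$. Then $D_{CT}(\cdot;\Gamma)$ is upper semicontinuous with respect to the Hausdorff distance $d_{\mathcal{H}}$, in the sense that $$\limsup_{n\to\infty}D_{CT}(K_n;\Gamma)\le D_{CT}(K;\Gamma)$$ for every $K\in\mathcal{K}_c(\mathbb{R}^p)$ and every sequence $\{K_n\}_n$ in $\mathcal{K}_c(\mathbb{R}^p)$ such that $\lim_{n\to\infty}d_{\mathcal{H}}(K,K_n)=0$.
   Context: $\mathcal{K}_c(\mathbb{R}^p)$ denotes the set of non-empty compact convex subsets of $\mathbb{R}^p$, and $\mathbb{S}^{p-1}=\{x\in\mathbb{R}^p:\|x\|=1\}$ the Euclidean unit sphere. The support function of $K\in\mathcal{K}_c(\mathbb{R}^p)$ is $s_K:\mathbb{S}^{p-1}\to\mathbb{R}$, $s_K(u)=\sup_{k\in K}\langle k,u\rangle$. The Hausdorff distance is $d_{\mathcal{H}}(K,L)=\max\{\sup_{k\in K}\inf_{l\in L}\|k-l\|,\ \sup_{l\in L}\inf_{k\in K}\|k-l\|\}$. A map $\Gamma:\Omega\to\mathcal{K}_c(\mathbb{R}^p)$ on a probability space $(\Omega,\mathcal{A},\mathbb{P})$ is a compact convex random set if $\{\omega\in\Omega:\Gamma(\omega)\cap K\ne\emptyset\}\in\mathcal{A}$ for all $K\in\mathcal{K}_c(\mathbb{R}^p)$; equivalently, it is Borel measurable with respect to the Hausdorff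 metric. For $u\in\mathbb{S}^{p-1}$, $t\in\mathbb{R}$, define the halfspaces $S^-_{u,t}=\{K\in\mathcal{K}_c(\mathbb{R}^p):s_K(u)\le t\}$ and $S^+_{u,t}=\{K\in\mathcal{K}_c(\mathbb{R}^p):s_K(u)\ge t\}$. The Tukey depth of $K\in\mathcal{K}_c(\mathbb{R}^p)$ with respect to $\Gamma$ is $$D_{CT}(K;\Gamma)=\min\Big\{\inf_{u\in\mathbb{S}^{p-1},\,t\in\mathbb{R}:\ K\in S^-_{u,t}}\mathbb{P}(\Gamma\in S^-_{u,t}),\ \inf_{u\in\mathbb{S}^{p-1},\,t\in\mathbb{R}:\ K\in S^+_{u,t}}\mathbb{P}(\Gamma\in S^+_{u,t})\Big\}.$$ *)

(* Defs.v *)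
From HB Require Import structures.
From mathcomp Require Export all_boot all_order all_algebra.
From mathcomp Require Export all_classical all_reals all_analysis.
Export Order.TTheory GRing.Theory Num.Theory.
Export numFieldNormedType.Exports.

Set Implicit Arguments.
Unset Strict Implicit.
Unset Printing Implicit Defensive.

Local Open Scope classical_set_scope.
Local Open Scope ring_scope.

(* The library norm `|x| on 'rV[R]_p is the max norm, hence the explicit
   Euclidean structure here.  The library topology on 'rV[R]_p, used by
   [compact] below, is the usual one. *)
Definition dotp (R : realType) (p : nat) (x y : 'rV[R]_p) : R :=
  \sum_(i < p) x ord0 i * y ord0 i.

Definition enorm (R : realType) (p : nat) (x : 'rV[R]_p) : R :=
  Num.sqrt (dotp x x).

Definition usphere (R : realType) (p : nat) : set 'rV[R]_p :=
  [set x | enorm x = 1].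
Arguments usphere : clear implicits.

Record convex_body (R : realType) (p : nat) := ConvexBody {
  body :> set 'rV[R]_p ;
  body_nonempty : body !=set0 ;
  body_compact : compact body ;
  body_convex : convex_set body }.

(* The real-valued [sup] and [inf] below are only taken over non-empty bounded
   sets, so their default values are never used. *)
Definition support (R : realType) (p : nat) (K : convex_body R p)
    (u : 'rV[R]_p) : R :=
  sup [set dotp k u | k in (K : set _)].

Definition hausdorff_dist (R : realType) (p : nat) (K L : convex_body R p) : R :=
  Num.max
    (sup [set inf [set enorm (k - l) | l in (L : set _)] | k in (K : set _)])
    (sup [set inf [set enorm (k - l) | k in (K : set _)] | l in (L : set _)]).

Definition random_convex_body (R : realType) (p : nat) (d : measure_display)
    (T : measurableType d) (Gamma : T -> convex_body R p) : Prop :=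
  forall K : convex_body R p,
    measurable [set w | (Gamma w : set _) `&` (K : set _) !=set0].

Definition halfspace_le (R : realType) (p : nat) (u : 'rV[R]_p) (t : R) :
    set (convex_body R p) :=
  [set K | support K u <= t].

Definition halfspace_ge (R : realType) (p : nat) (u : 'rV[R]_p) (t : R) :
    set (convex_body R p) :=
  [set K | support K u >= t].

(* The infima are taken over pairs (u, t) with u on the unit sphere. *)
Definition tukey_depth (R : realType) (p : nat) (d : measure_display)
    (T : measurableType d) (P : probability T R) (Gamma : T -> convex_body R p)
    (K : convex_body R p) : \bar R :=
  Order.min
    (ereal_inf [set P (Gamma @^-1` halfspace_le ut.1 ut.2) |
       ut in [set ut | usphere R p ut.1 /\ halfspace_le ut.1 ut.2 K]])
    (ereal_inf [set P (Gamma @^-1` halfspace_ge ut.1 ut.2) |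
       ut in [set ut | usphere R p ut.1 /\ halfspace_ge ut.1 ut.2 K]]).

(* Main.v *)
Require Import Defs.
From mathcomp Require Import ring lra.

(** The depth is an infimum, over pairs (u, t) whose halfspace contains K, of
    probabilities of halfspaces, and a halfspace that contains K contains K_n
    for all large n as soon as its threshold t is relaxed by some e > 0.
    Indeed, for a unit vector u, the map sending K to [support K u] is
    1-Lipschitz for the Hausdorff distance ([support_lipschitz]).  Hence the
    limsup of the depths of K_n is at most P(support Gamma u <= t + e) for
    every e > 0.  Letting e tend to 0, right continuity of the distribution
    function of the real random variable [support Gamma u] gives the bound
    P(support Gamma u <= t) ([le_probability_sublevel]); the halfspaces
    support >= t are handled by the same argument applied to the opposite
    random variable.  Taking the infimum over (u, t) concludes.

    The passage to the limit needs [support Gamma u] to be measurable, whereas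
    the hypothesis on Gamma only speaks of its hitting a convex body.  Since
    the supremum defining the support function is attained, support Gamma u
    >= t means that Gamma meets the halfspace of the x with t <= <x, u>.  That
    halfspace is not compact, but it is the countable union of its
    intersections with centred balls, which are compact and convex
    ([measurable_support]). *)

Set Implicit Arguments.
Unset Strict Implicit.
Unset Printing Implicit Defensive.

Local Open Scope classical_set_scope.
Local Open Scope ring_scope.

Lemma dotpBl (R : realType) (p : nat) (x y z : 'rV[R]_p) :
  dotp (x - y) z = dotp x z - dotp y z.
Proof. by rewrite -sumrB; apply: eq_bigr => i _; rewrite !mxE mulrBl. Qed.

Lemma enormC (R : realType) (p : nat) (x y : 'rV[R]_p) :
  enorm (x - y) = enorm (y - x).
Proof.
by congr Num.sqrt; apply: eq_bigr => i _; rewrite !mxE -mulrNN !opprB.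
Qed.

(** Cauchy-Schwarz against a unit vector: expand the squared distance from x
    to its projection on the line spanned by u, which is nonnegative. *)
Lemma dotp_le_enorm (R : realType) (p : nat) (u x : 'rV[R]_p) :
  usphere R p u -> dotp x u <= enorm x.
Proof.
move=> u1.
have uu : dotp u u = 1.
  have uu_ge0 : 0 <= dotp u u by apply: sumr_ge0 => i _; rewrite -expr2 sqr_ge0.
  by rewrite -(sqr_sqrtr uu_ge0) -/(enorm u) u1 expr1n.
apply: (le_trans (ler_norm _)); rewrite -sqrtr_sqr; apply: ler_wsqrtr.
have sq_dist c : \sum_(i < p) (x ord0 i - c * u ord0 i) ^+ 2 =
    dotp x x - 2 * c * dotp x u + c ^+ 2 * dotp u u.
  rewrite !mulr_sumr -sumrB -big_split /=.
  by apply: eq_bigr => i _; ring.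
have : 0 <= \sum_(i < p) (x ord0 i - dotp x u * u ord0 i) ^+ 2.
  by apply: sumr_ge0 => i _; exact: sqr_ge0.
rewrite sq_dist uu; nra.
Qed.

Lemma continuous_dotp (R : realType) (p : nat) (T : topologicalType)
    (f g : T -> 'rV[R]_p) :
  continuous f -> continuous g -> continuous (fun x => dotp (f x) (g x)).
Proof.
move=> cf cg x; apply: cvg_big; first exact: add_continuous.
move=> i _; apply: cvgM.
  apply: (cvg_comp f (fun M : 'rV[R]_p => M ord0 i)); first exact: cf.
  exact: coord_continuous.
apply: (cvg_comp g (fun M : 'rV[R]_p => M ord0 i)); first exact: cg.
exact: coord_continuous.
Qed.

Lemma continuous_dotpl (R : realType) (p : nat) (u : 'rV[R]_p) :
  continuous (fun x : 'rV[R]_p => dotp x u).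
Proof.
apply: (@continuous_dotp R p _ id (fun=> u)) => x; first exact: cvg_id.
exact: cst_continuous.
Qed.

Lemma continuous_enorm_sub (R : realType) (p : nat) (l : 'rV[R]_p) :
  continuous (fun x : 'rV[R]_p => enorm (x - l)).
Proof.
have cB : continuous (fun x : 'rV[R]_p => x - l).
  by move=> x; apply: (@continuousB _ _ _ id (fun=> l));
    [exact: cvg_id|exact: cst_continuous].
move=> x.
apply: (continuous_comp (f := fun x : 'rV[R]_p => dotp (x - l) (x - l))
                        (g := Num.sqrt)).
  exact: (continuous_dotp cB cB).
exact: sqrt_continuous.
Qed.

Lemma body_max (R : realType) (p : nat) (K : convex_body R p)
    (f : 'rV[R]_p -> R) :
  continuous f ->
  exists2 k, (K : set _) k & forall l, (K : set _) l -> f l <= f k.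
Proof.
move=> cf.
have [|k kK kmax] := EVT_max_rV (body_nonempty K) (@body_compact _ _ K) (f := f).
  exact: continuous_subspaceT.
by exists k; [exact: set_mem|move=> l lK; apply: kmax; exact: mem_set].
Qed.

Lemma support_attained (R : realType) (p : nat) (K : convex_body R p)
    (u : 'rV[R]_p) :
  exists2 k, (K : set _) k & dotp k u = support K u.
Proof.
have [k kK kmax] := body_max K (@continuous_dotpl R p u).
have ub : ubound [set dotp k u | k in (K : set _)] (dotp k u).
  by move=> _ [l lK <-]; exact: kmax.
exists k => //; apply/eqP; rewrite eq_le; apply/andP; split.
  by apply: ub_le_sup; [exists (dotp k u)|exists k].
by apply: ge_sup => //; exists (dotp k u); exists k.
Qed.

Lemma dotp_le_support (R : realType) (p : nat) (K : convex_body R p)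
    (u k : 'rV[R]_p) :
  (K : set _) k -> dotp k u <= support K u.
Proof.
move=> kK; apply: ub_le_sup; last by exists k.
have [l lK lmax] := body_max K (@continuous_dotpl R p u).
by exists (dotp l u) => _ [x xK <-]; exact: lmax.
Qed.

(** If k attains the support of K, then every l in L satisfies
    <k, u> = <k - l, u> + <l, u> <= |k - l| + support L u; optimize over l.
    The supremum on the right is the one-sided half of the Hausdorff
    distance. *)
Lemma support_le_excess (R : realType) (p : nat) (K L : convex_body R p)
    (u : 'rV[R]_p) :
  usphere R p u ->
  support K u <= support L u +
    sup [set inf [set enorm (k - l) | l in (L : set _)] | k in (K : set _)].
Proof.
move=> u1; have [k kK <-] := support_attained K u.
have [l0 l0L] := body_nonempty L.
have [m mK mmax] := body_max K (@continuous_enorm_sub R p l0).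
rewrite -lerBlDl.
apply: (@le_trans _ _ (inf [set enorm (k - l) | l in (L : set _)])).
  apply: lb_le_inf; first by exists (enorm (k - l0)); exists l0.
  move=> _ [l lL <-]; apply: le_trans (dotp_le_enorm _ u1).
  by rewrite dotpBl lerB // dotp_le_support.
apply: ub_le_sup; last by exists k.
(* The distances to L are bounded on K by the farthest distance to l0. *)
exists (enorm (m - l0)) => _ [x xK <-].
apply: le_trans (mmax _ xK); apply: ge_inf; last by exists l0.
by exists 0 => _ [l _ <-]; exact: sqrtr_ge0.
Qed.

Lemma support_lipschitz (R : realType) (p : nat) (K L : convex_body R p)
    (u : 'rV[R]_p) :
  usphere R p u -> `|support K u - support L u| <= hausdorff_dist K L.
Proof.
move=> u1; have KL := support_le_excess K L u1.
have := support_le_excess L K u1.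
rewrite (_ : [set inf _ | k in (L : set _)] =
    [set inf [set enorm (k - l) | k in (K : set _)] | l in (L : set _)]).
  move=> LK; rewrite /hausdorff_dist le_max !ler_norml.
  case: (leP (support K u) (support L u)) => h; apply/orP.
    by right; apply/andP; split; lra.
  by left; apply/andP; split; lra.
apply: eq_imagel => l _; congr inf; apply: eq_imagel => k _; exact: enormC.
Qed.

(** The test bodies for measurability.  Only compactness and convexity of the
    balls that exhaust the halfspace matter, so the ambient max norm is used
    instead of the Euclidean one. *)
Lemma convex_half_ball (R : realType) (p : nat) (u : 'rV[R]_p) (t r : R) :
  convex_set [set x : 'rV[R]_p | t <= dotp x u /\ `|x| <= r].
Proof.
move=> x y a /set_mem[xt xr] /set_mem[yt yr]; apply: mem_set.
have a0 : 0 <= a%:num by [].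
have a1 : 0 <= 1 - a%:num by rewrite subr_ge0.
rewrite (_ : conv a x y =
  a%:num *: (x : 'rV[R]_p) + (1 - a%:num) *: (y : 'rV[R]_p)) //.
split.
  rewrite (_ : dotp _ u = a%:num * dotp x u + (1 - a%:num) * dotp y u).
    by nra.
  by rewrite !mulr_sumr -big_split; apply: eq_bigr => i _; rewrite !mxE /=; ring.
apply: (le_trans (ler_normD _ _)); rewrite !normrZ !ger0_norm //; nra.
Qed.

Lemma compact_half_ball (R : realType) (p : nat) (u : 'rV[R]_p) (t r : R) :
  compact [set x : 'rV[R]_p | t <= dotp x u /\ `|x| <= r].
Proof.
apply: bounded_closed_compact.
  exists r; split; first exact: num_real.
  by move=> M rM x [_ xr]; exact: le_trans xr (ltW rM).
apply: closedI.
  apply: (@closed_comp _ _ (fun x : 'rV[R]_p => dotp x u) [set y | t <= y]);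
    last exact: closed_ge.
  by move=> x _; exact: continuous_dotpl.
apply: (@closed_comp 'rV[R]_p R (fun x => `|x|) [set y | y <= r]);
  last exact: closed_le.
by move=> x _; exact: norm_continuous.
Qed.

(** The superlevel set at t is the union over n of the events that Gamma hits
    the n-th half ball of level t: a maximizer of <., u> over Gamma lies in
    some ball. *)
Lemma measurable_support (R : realType) (p : nat) (d : measure_display)
    (T : measurableType d) (Gamma : T -> convex_body R p) (u : 'rV[R]_p) :
  random_convex_body Gamma ->
  measurable_fun setT (fun w => support (Gamma w) u).
Proof.
move=> mGamma.
apply: (measurability _ (measurable_realfun.RGenCInfty.measurableE R)).
move=> _ [_ [t ->] <-]; rewrite setTI.
rewrite (_ : _ @^-1` _ = \bigcup_n [set w | (Gamma w : set _) `&`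
    [set x : 'rV[R]_p | t <= dotp x u /\ `|x| <= n%:R] !=set0]).
  apply: bigcupT_measurable => n.
  (* A convex body is nonempty, so an empty half ball is treated apart. *)
  have [B0|/set0P/negP/negPn/eqP B0] :=
      pselect ([set x : 'rV[R]_p | t <= dotp x u /\ `|x| <= n%:R] !=set0).
    exact: (mGamma (ConvexBody B0 (@compact_half_ball _ _ u t n%:R)
      (@convex_half_ball _ _ u t n%:R))).
  rewrite B0 (_ : [set w | _] = set0); first exact: measurable0.
  by apply/seteqP; split => // w /=; rewrite setI0 => -[].
apply/seteqP; split => w /=; rewrite in_itv /= andbT.
  move=> tw; have [k kG ks] := support_attained (Gamma w) u.
  exists (Num.truncn `|k|).+1 => //; exists k; split => //.
  split; first by rewrite ks.
  exact: ltW (truncnS_gt _).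
by case=> n _ [x [xG [tx _]]]; exact: le_trans tx (dotp_le_support _ xG).
Qed.

(** The sublevel sets of f at t + e decrease to the one at t, so this is right
    continuity of the distribution function of f. *)
Lemma le_probability_sublevel (R : realType) (d : measure_display)
    (T : measurableType d) (P : probability T R) (f : T -> R) (t : R)
    (a : \bar R) :
  measurable_fun setT f ->
  (forall e : R, 0 < e -> (a <= P [set w | (f w <= t + e)%R])%E) ->
  (a <= P [set w | (f w <= t)%R])%E.
Proof.
move=> mf aP.
pose X := mfun_Sub (mem_set mf) : {RV P >-> R}.
have cdfX s : cdf X s = P [set w | f w <= s].
  by rewrite /cdf /distribution /= /pushforward; congr (P _);
     apply/seteqP; split => w /=; rewrite in_itv.
have cX := @cdf_right_continuous _ _ _ P X t.
rewrite -cdfX; apply: (cvge_to_ge cX).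
near=> s; rewrite cdfX -(subrK t s) addrC; apply: aP.
by rewrite subr_gt0; near: s; exact: nbhs_right_gt.
Unshelve. all: by end_near. Qed.

Lemma limn_esup_le_near (R : realType) (v : nat -> \bar R) (c : \bar R) :
  (\forall n \near \oo, (v n <= c)%E) -> (limn_esup v <= c)%E.
Proof.
move=> vc; rewrite /limn_esup limf_esupE.
apply: (@le_trans _ _ (ereal_sup [set v n | n in [set n | (v n <= c)%E]])).
  by apply: ereal_inf_lbound; exists [set n | (v n <= c)%E].
by apply: ge_ereal_sup => _ [n vn <-].
Qed.

Theorem proposition4p9 (R : realType) (p : nat) (hp : (1 <= p)%N)
    (d : measure_display) (T : measurableType d) (P : probability T R)
    (Gamma : T -> convex_body R p) (hGamma : random_convex_body Gamma)
    (K : convex_body R p) (K_ : nat -> convex_body R p)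
    (hK : (fun n => hausdorff_dist K (K_ n)) @ \oo --> (0 : R)) :
  (limn_esup (fun n => tukey_depth P Gamma (K_ n)) <= tukey_depth P Gamma K)%E.
Proof.
have near_support u e : usphere R p u -> 0 < e ->
    \forall n \near \oo, `|support K u - support (K_ n) u| < e.
  move=> u1 e0; apply: (filterS _ (cvgr_lt 0 hK e e0)) => n.
  exact: le_lt_trans (support_lipschitz _ _ u1).
rewrite [leRHS]/tukey_depth le_min; apply/andP; split;
  apply: le_ereal_inf_tmp => _ [[u t] [/= u1 Kt] <-].
(* Relaxing the threshold to t + e brings K_ n into the halfspace. *)
- apply: (@le_probability_sublevel _ _ _ P (fun w => support (Gamma w) u)).
    exact: measurable_support.
  move=> e e0; apply: limn_esup_le_near.
  apply: (filterS _ (near_support u e u1 e0)) => n.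
  rewrite ltr_distlC => /andP[_ Kn].
  rewrite /tukey_depth ge_min; apply/orP; left.
  apply: ereal_inf_lbound; exists (u, t + e) => //; split => //=.
  by rewrite /halfspace_le /= in Kt *; lra.
(* The threshold relaxes to t - e, that is, to - t + e for the opposite of the
   support function. *)
- rewrite (_ : _ @^-1` _ = [set w | - support (Gamma w) u <= - t]); last first.
    by apply/seteqP; split => w /=; rewrite lerN2.
  apply: le_probability_sublevel.
    by apply: measurableT_comp => //; exact: measurable_support.
  move=> e e0; apply: limn_esup_le_near.
  apply: (filterS _ (near_support u e u1 e0)) => n.
  rewrite ltr_distlC => /andP[Kn _].
  rewrite /tukey_depth ge_min; apply/orP; right.
  apply: ereal_inf_lbound; exists (u, t - e); first split => //=.
    by rewrite /halfspace_ge /= in Kt *; lra.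
  by congr (P _); apply/seteqP; split => w /=; rewrite /halfspace_ge /=; lra.
Qed.
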